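(* Let $G$ be a finite reflexive undirected graph with a tree decomposition $T$ such that any two bags of $T$ intersect in a set inducing a clique of $G$. Then \[ c(G)\leq \max_{B\in T}\mathrm{rcc}_G(\langle B\rangle)+1, \] where the maximum ranges over all bags $B$ of $T$ and $\langle B\rangle$ denotes the subgraph of $G$ induced by $B$.
   Context: Graphs are finite, undirected and reflexive (every vertex has a loop). Cops and Robbers: a set of cops and a single robber occupy vertices; the cops first choose initial vertices, then the robber chooses his initial vertex, and then the players alternate, the cops moving first. On a move, each cop (any subset of the cops may move) and, on his turn, the robber moves to a neighbouring vertex or stays put. The cops win if after finitely many rounds some cop occupies the robber's vertex; the robber wins if he evades capture forever. The cop number $c(G)$ is the minimum number of cops that have a winning strategy on $G$. An induced subgraph $H$ of $G$ is a retract if there is a graph homomorphism $f$ from $G$ onto $H$ with $f(x)=x$ for all $x\in V(H)$. For a retract $H$, $\mathrm{guard}(H)$ is the minimum number of cops that, playing in $G$, can ensure that after finitely many rounds, if the robber ever moves onto a vertex of $H$ he is immediately captured (on the cops' next move). For an induced subgraph $H$ of $G$, a retract cover of $H$ in $G$ is a set $\{H_i: i\in I\}$ of induced subgraphs of $G$, each a retract of $G$ (not necessarily disjoint), whose union contains $H$. The retract cover cop number is $\mathrm{rcc}_G(H)=\min \sum_{i\in I}\mathrm{guard}(H_i)$, the minimum over all retract covers $\{H_i\}$ of $H$ in $G$. A tree decomposition of $G=(V,E)$ is a pair consisting of a family of subsets (bags) $X_1,\dots,X_n$ of $V$ and a tree $T$ whose vertices are the bags, such that: (1) $V=\bigcup_i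 X_i$; (2) for every edge $vw$ of $G$ some bag contains both $v$ and $w$; (3) if $X_k$ lies on the path in $T$ from $X_i$ to $X_j$ then $X_i\cap X_j\subseteq X_k$.
   Formalization: The graph G is additionally assumed connected; without this the inequality fails, e.g. for three isolated vertices with singleton bags along a path, where c(G)=3 but the bound is at most 2. *)

(* Defs.v *)
From mathcomp Require Import all_boot.
From mathcomp Require Import boolp.

Set Implicit Arguments.
Unset Strict Implicit.
Unset Printing Implicit Defensive.

Record refl_graph := ReflGraph {
  vertex :> finType;
  adj : rel vertex;
  adj_refl : reflexive adj;
  adj_sym : symmetric adj
}.

Definition connected_graph (G : refl_graph) : Prop :=
  forall x y : G, connect (@adj G) x y.

Definition clique (G : refl_graph) (A : {set G}) : Prop :=
  {in A &, forall x y, adj x y}.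

(** [r n] is the robber's position when the cops are about to make their
    [n]-th move (counting from 0); staying put is moving along a loop. *)
Definition walk (G : refl_graph) (r : nat -> G) : Prop :=
  forall n, adj (r n) (r n.+1).

(** A strategy sends the sequence of robber positions seen so far to the
    resulting cop positions.  [s [::]] is the initial placement, chosen before
    the robber's, and against [r] the cops stand at [s (mkseq r n)] just
    before their [n]-th move and at [s (mkseq r n.+1)] just after it. *)
Definition strategy (G : refl_graph) (k : nat) := seq G -> 'I_k -> G.

Definition legal (G : refl_graph) (k : nat) (s : strategy G k) : Prop :=
  forall r, walk r ->
  forall n i, adj (s (mkseq r n) i) (s (mkseq r n.+1) i).

(** A cop stands on the robber's [n]-th position, either already when the
    robber arrives there or after the cops' next move. *)
Definition caught (G : refl_graph) (k : nat) (s : strategy G k) (r : nat -> G)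
    (n : nat) : Prop :=
  exists i, s (mkseq r n) i = r n \/ s (mkseq r n.+1) i = r n.

Definition cops_win (G : refl_graph) (k : nat) : Prop :=
  exists2 s : strategy G k, legal s &
    forall r, walk r -> exists n, caught s r n.

(** In every play [r] there is a moment [N] from which the guard is in place:
    however the robber continues from then on ([r']), unless he has been caught
    earlier, whenever he moves onto [H] he is caught at once. *)
Definition cops_guard (G : refl_graph) (H : {set G}) (k : nat) : Prop :=
  exists2 s : strategy G k, legal s &
    forall r, walk r -> exists N,
      forall r', walk r' -> (forall n, n <= N -> r' n = r n) ->
      forall n, N <= n -> (forall m, m < n -> ~ caught s r' m) ->
      r' n \in H -> caught s r' n.

Lemma everywhere_legal (G : refl_graph) :
  @legal G #|G| (fun _ i => enum_val i).
Proof. by move=> r _ n i; apply: adj_refl. Qed.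

Lemma everywhere_caught (G : refl_graph) (r : nat -> G) (n : nat) :
  @caught G #|G| (fun _ i => enum_val i) r n.
Proof. by exists (enum_rank (r n)); left; rewrite enum_rankK. Qed.

Lemma ex_cops_win (G : refl_graph) : exists k, `[< cops_win G k >].
Proof.
exists #|G|; apply/asboolP; exists (fun _ i => enum_val i).
  exact: everywhere_legal.
by move=> r _; exists 0; apply: everywhere_caught.
Qed.

Lemma ex_cops_guard (G : refl_graph) (H : {set G}) :
  exists k, `[< cops_guard H k >].
Proof.
exists #|G|; apply/asboolP; exists (fun _ i => enum_val i).
  exact: everywhere_legal.
by move=> r _; exists 0 => r' _ _ n _ _ _; apply: everywhere_caught.
Qed.

Definition cop_number (G : refl_graph) : nat := ex_minn (ex_cops_win G).

Definition guard (G : refl_graph) (H : {set G}) : nat := ex_minn (ex_cops_guard H).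

(** Induced subgraphs are represented by their vertex sets. *)
Definition retract (G : refl_graph) (H : {set G}) : bool :=
  [exists f : {ffun G -> G},
    [&& [forall x, f x \in H],
        [forall x in H, f x == x] &
        [forall x, forall y, adj x y ==> adj (f x) (f y)]]].

Definition retract_cover (G : refl_graph) (B : {set G}) (F : {set {set G}}) : bool :=
  [forall H in F, retract H] && (B \subset cover F).

Lemma ex_retract_cover (G : refl_graph) (B : {set G}) :
  exists k, [exists F : {set {set G}},
    retract_cover B F && (\sum_(H in F) guard H == k)].
Proof.
exists (\sum_(H in [set [set: G]]) guard H).
apply/existsP; exists [set [set: G]]; rewrite eqxx andbT; apply/andP; split.
  apply/forall_inP => H /set1P ->; apply/existsP; exists [ffun x => x].
  apply/and3P; split; first by apply/forallP => x; rewrite inE.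
    by apply/forall_inP => x _; rewrite ffunE.
  by apply/forallP => x; apply/forallP => y; rewrite !ffunE; apply/implyP.
by rewrite /cover big_set1 subsetT.
Qed.

Definition rcc (G : refl_graph) (B : {set G}) : nat := ex_minn (ex_retract_cover B).

Definition tree (I : finType) (t : rel I) : Prop :=
  [/\ 0 < #|I|, symmetric t, irreflexive t,
      forall i j, connect t i j &
      forall c : seq I, ucycle t c -> size c <= 2].

Definition tree_decomposition (G : refl_graph) (I : finType) (t : rel I)
    (X : I -> {set G}) : Prop :=
  [/\ tree t,
      \bigcup_i X i = [set: G],
      forall v w : G, adj v w -> exists i, (v \in X i) /\ (w \in X i) &
      forall (i j k : I) (p : seq I),
        path t i p -> uniq (i :: p) -> last i p = j -> k \in i :: p ->
        X i :&: X j \subset X k].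

(* Main.v *)
(** Let [m] be the maximum of [rcc] over the bags, so that [m] cops suffice to
    guard any single bag; play with one extra cop.  The extra cop sits on the
    clique separating the robber's side of the tree from the rest, and so
    confines him there, while the others set up a guard of the first bag on that
    side.  The robber is then beyond that bag, in a smaller subtree, and while
    the bag stays guarded the extra cop walks to the next separating clique.

    The phases are chained by contradiction: from a position that is not won,
    the robber can evade any prescribed strategy while staying in positions that
    are not won, so no winning strategy has to be assembled by hand. *)
Require Import Defs.
From mathcomp Require Import all_boot.
From mathcomp Require Import boolp.

Set Implicit Arguments.
Unset Strict Implicit.
Unset Printing Implicit Defensive.

(** * Robber walks and their histories *)

Lemma mkseqS_head (T : Type) (r : nat -> T) (n : nat) :
  mkseq r n.+1 = r 0 :: mkseq (fun m => r m.+1) n.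
Proof.
rewrite /mkseq /= -[1]/(1 + 0) iotaDl -map_comp; congr (_ :: _).
Qed.

Lemma walk_behead (G : refl_graph) (r : nat -> G) :
  walk r -> walk (fun n => r n.+1).
Proof. by move=> rW n; apply: rW. Qed.

Lemma walk_cons (G : refl_graph) (x : G) (r : nat -> G) :
  walk r -> adj x (r 0) -> walk (fun n => if n is m.+1 then r m else x).
Proof. by move=> rW xr [|n]. Qed.

Definition splice (T : Type) (N : nat) (r r' : nat -> T) (n : nat) : T :=
  if n < N then r n else r' (n - N).

Lemma spliceD (T : Type) (N : nat) (r r' : nat -> T) (n : nat) :
  splice N r r' (N + n) = r' n.
Proof. by rewrite /splice ltnNge leq_addr addKn. Qed.

Lemma splice_le (T : Type) (N : nat) (r r' : nat -> T) (n : nat) :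
  r' 0 = r N -> n <= N -> splice N r r' n = r n.
Proof.
move=> r'0; rewrite leq_eqVlt /splice => /orP[/eqP->|-> //].
by rewrite ltnn subnn.
Qed.

Lemma mkseq_splice (T : Type) (N : nat) (r r' : nat -> T) (n : nat) :
  mkseq (splice N r r') (N + n) = mkseq r N ++ mkseq r' n.
Proof.
rewrite /mkseq iotaD map_cat add0n; congr (_ ++ _).
  by apply/eq_in_map => a; rewrite mem_iota add0n /splice => /andP[_ ->].
have -> : iota N n = map (addn N) (iota 0 n) by rewrite -iotaDl addn0.
by rewrite -map_comp; apply: eq_map => a /=; apply: spliceD.
Qed.

Lemma walk_splice (G : refl_graph) (N : nat) (r r' : nat -> G) :
  walk r -> walk r' -> r' 0 = r N -> walk (splice N r r').
Proof.
move=> rW r'W r'0 n; case: (ltnP n N) => [ltnN|leNn].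
  by rewrite !splice_le // ltnW.
by rewrite -(subnKC leNn) -addnS !spliceD.
Qed.

Lemma eq_mkseq_lt (T : Type) (r r' : nat -> T) (n : nat) :
  (forall m, m < n -> r m = r' m) -> mkseq r n = mkseq r' n.
Proof.
move=> eqr; apply/eq_in_map => m; rewrite mem_iota add0n => /andP[_].
exact: eqr.
Qed.

Lemma walk_to (G : refl_graph) (a b : G) :
  connected_graph G ->
  exists w : nat -> G,
    [/\ walk w, w 0 = a & exists D, forall n, D <= n -> w n = b].
Proof.
move=> /(_ a b)/connectP[p pP ->].
(* The default of [nth] is the endpoint, so the walk waits there once the path is used up. *)
exists (nth (last a p) (a :: p)); split=> //; last first.
  by exists (size p).+1 => n leDn; rewrite nth_default.
move=> n; case: (ltnP n (size p)) => [ltnp|lepn].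
  exact: (pathP (last a p) pP).
rewrite [X in adj _ X]nth_default //.
move: lepn; rewrite leq_eqVlt => /orP[/eqP<-|ltpn].
  by rewrite -last_nth adj_refl.
by rewrite nth_default // adj_refl.
Qed.

Lemma walks_to (G : refl_graph) (k : nat) (c d : 'I_k -> G) :
  connected_graph G ->
  exists w : nat -> 'I_k -> G,
    [/\ forall n i, adj (w n i) (w n.+1 i), w 0 = c & exists D, w D = d].
Proof.
move=> Gconn.
have [w wP] := choice (fun i => walk_to (c i) (d i) Gconn).
have /choice[D DP] i : exists D, forall n, D <= n -> w i n = d i by have [] := wP i.
exists (fun n i => w i n); split; first by move=> n i; have [] := wP i.
  by apply: funext => i; have [] := wP i.
exists (\max_i D i); apply: funext => i; apply: DP.
exact: leq_bigmax.
Qed.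

(** * Teams of cops playing side by side, and guarding *)

Definition cops_join (T : Type) (a b : nat) (c : 'I_a -> T) (d : 'I_b -> T)
    (i : 'I_(a + b)) : T :=
  match split i with inl j => c j | inr j => d j end.

Lemma cops_join_lshift (T : Type) (a b : nat) (c : 'I_a -> T) (d : 'I_b -> T) i :
  cops_join c d (lshift b i) = c i.
Proof. by rewrite /cops_join -[lshift b i]/(unsplit (inl i)) unsplitK. Qed.

Lemma cops_join_rshift (T : Type) (a b : nat) (c : 'I_a -> T) (d : 'I_b -> T) i :
  cops_join c d (rshift a i) = d i.
Proof. by rewrite /cops_join -[rshift a i]/(unsplit (inr i)) unsplitK. Qed.

Lemma cops_join_shift (T : Type) (a b : nat) (c : 'I_(a + b) -> T) :
  cops_join (fun i => c (lshift b i)) (fun i => c (rshift a i)) = c.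
Proof.
apply: funext => i; rewrite /cops_join -{2}[i]splitK /unsplit.
by case: (split i).
Qed.

Lemma cops_join_adj (G : refl_graph) (a b : nat) (c c' : 'I_a -> G)
    (d d' : 'I_b -> G) :
  (forall i, adj (c i) (c' i)) -> (forall i, adj (d i) (d' i)) ->
  forall i, adj (cops_join c d i) (cops_join c' d' i).
Proof. by move=> cc' dd' i; rewrite /cops_join; case: (split i). Qed.

(** The two teams ignore each other. A catch by either is a catch by both together, so a robber
    uncaught by the joint team is uncaught by each, and both guards apply after the later of the two
    moments. *)
Lemma cops_guardU (G : refl_graph) (A B : {set G}) (a b : nat) :
  cops_guard A a -> cops_guard B b -> cops_guard (A :|: B) (a + b).
Proof.
move=> [s sL sG] [s' s'L s'G].
pose S : strategy G (a + b) := fun h => cops_join (s h) (s' h).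
have Sl r n : caught s r n -> caught S r n.
  by move=> [i]; exists (lshift b i); rewrite /S !cops_join_lshift.
have Sr r n : caught s' r n -> caught S r n.
  by move=> [i]; exists (rshift a i); rewrite /S !cops_join_rshift.
exists S.
  by move=> r rW n; apply: cops_join_adj => i; [apply: sL | apply: s'L].
move=> r rW.
have [N NP] := sG r rW; have [N' N'P] := s'G r rW.
exists (maxn N N') => r' r'W eqr n; rewrite geq_max => /andP[leNn leN'n] nc.
case/setUP => rn.
  apply: (Sl); apply: NP => // [m lemN|m ltmn /Sl]; last exact: nc.
  by apply: eqr; rewrite leq_max lemN.
apply: (Sr); apply: N'P => // [m lemN|m ltmn /Sr]; last exact: nc.
by apply: eqr; rewrite leq_max lemN orbT.
Qed.

Lemma cops_guard_subset (G : refl_graph) (A B : {set G}) (k : nat) :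
  A \subset B -> cops_guard B k -> cops_guard A k.
Proof.
move=> /subsetP AB [s sL sG]; exists s => // r rW; have [N NP] := sG r rW.
by exists N => r' r'W eqr n leNn nc /AB; apply: NP.
Qed.

Lemma cops_guard0 (G : refl_graph) (k : nat) (x : G) :
  cops_guard (set0 : {set G}) k.
Proof.
exists (fun _ _ => x) => [r _ n i|r _]; first exact: adj_refl.
by exists 0 => r' _ _ n _ _; rewrite inE.
Qed.

Lemma guardP (G : refl_graph) (H : {set G}) : cops_guard H (guard H).
Proof. by rewrite /guard; case: ex_minnP => k /asboolP. Qed.

(** The guards of the members of an optimal cover add up; surplus cops idle at [x]. *)
Lemma rcc_cops_guard (G : refl_graph) (B : {set G}) (k : nat) (x : G) :
  rcc B <= k -> cops_guard B k.
Proof.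
rewrite /rcc; case: ex_minnP => m /existsP[F /andP[/andP[_ BF] /eqP mE]] _ lemk.
suff gF : cops_guard (cover F) m.
  rewrite -(subnKC lemk); apply: (@cops_guard_subset _ _ (cover F :|: set0)).
    by rewrite setU0.
  by apply: cops_guardU; last apply: cops_guard0.
rewrite -mE /cover.
apply: (big_ind2 (@cops_guard G)) => [|A a A' a'|H _]; first exact: cops_guard0.
  exact: cops_guardU.
exact: guardP.
Qed.

(** * Winning positions and strategies *)

(** [win c x]: with the cops at [c] and about to move, the robber at [x] can be
    caught in bounded time. *)
Inductive win (G : refl_graph) (k : nat) : ('I_k -> G) -> G -> Prop :=
| win_catch c c' x i : (forall j, adj (c j) (c' j)) -> c' i = x -> win c x
| win_step c c' x : (forall j, adj (c j) (c' j)) ->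
    (forall y, adj x y -> win c' y) -> win c x.

Definition legal_from (G : refl_graph) (k : nat) (s : strategy G k) (x : G) :=
  forall r, walk r -> r 0 = x ->
  forall n i, adj (s (mkseq r n) i) (s (mkseq r n.+1) i).

(** Induction on the derivation of [win]: after a [win_step], follow the strategy chosen for the
    robber's reply, dropping the first entry of the history. *)
Lemma win_strategy (G : refl_graph) (k : nat) (c : 'I_k -> G) (x : G) :
  win c x ->
  exists s : strategy G k,
    [/\ s [::] = c, legal_from s x &
        forall r, walk r -> r 0 = x -> exists n, caught s r n].
Proof.
elim=> {c x} [c c' x i cc' c'i|c c' x cc' _ IH].
  exists (fun h => if h is [::] then c else c'); split=> //.
    by move=> r _ _ [|n] j; rewrite !mkseqS_head //= adj_refl.
  by move=> r _ r0; exists 0, i; right; rewrite r0.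
have /choice[sy syP] y : exists s : strategy G k, adj x y ->
    [/\ s [::] = c', legal_from s y &
        forall r, walk r -> r 0 = y -> exists n, caught s r n].
  case xy: (adj x y); last by exists (fun _ => c').
  by have [s sP] := IH y xy; exists s.
(* When [h'] is empty the robber has not replied yet. The default [x] is then harmless: it is a
   legal reply by the loop, and the strategies for all replies start from [c']. *)
pose S h := if h is _ :: h' then sy (head x h') h' else c.
have SE r n : walk r -> r 0 = x ->
    S (mkseq r n.+1) = sy (r 1) (mkseq (fun m => r m.+1) n).
  move=> rW r0; rewrite mkseqS_head /=; case: n => [|n] //=.
  have [-> _ _] := syP x (adj_refl x).
  by have [|-> _ _] // := syP (r 1); rewrite -r0; apply: rW.
exists S; split=> // [r rW r0 [|n] i|r rW r0].
  - have [|s0 _ _] := syP (r 1); first by rewrite -r0; apply: rW.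
    by rewrite SE //= s0.
  - have [|_ sL _] := syP (r 1); first by rewrite -r0; apply: rW.
    by rewrite !SE //; apply: sL => //; apply: walk_behead.
have [|_ _ /(_ _ (walk_behead rW) erefl)[n [i ni]]] := syP (r 1).
  by rewrite -r0; apply: rW.
by exists n.+1, i; rewrite !SE.
Qed.

Lemma win_cops_win (G : refl_graph) (k : nat) (c : 'I_k -> G) :
  (forall x, win c x) -> cops_win G k.
Proof.
move=> /(fun H x => win_strategy (H x))/choice[s sP].
pose S h := if h is x :: _ then s x h else c.
have SE r n : S (mkseq r n) = s (r 0) (mkseq r n).
  by case: n => [|n]; [have [-> _ _] := sP (r 0) | rewrite mkseqS_head].
exists S => [r rW n i|r rW].
  by rewrite !SE; have [_ sL _] := sP (r 0); apply: sL.
have [_ _ /(_ _ rW erefl)[n [i ni]]] := sP (r 0).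
by exists n, i; rewrite !SE.
Qed.

(** If every reply of the robber led to a win, [win_step] would make the present position a win. So
    some reply does not, and such replies can be chosen forever. *)
Lemma not_win_walk (G : refl_graph) (k : nat) (s : strategy G k) (x : G) :
  legal_from s x -> ~ win (s [::]) x ->
  exists r, [/\ walk r, r 0 = x & forall n, ~ win (s (mkseq r n)) (r n)].
Proof.
move=> sL sx.
(* A state is what remains of the strategy after the past history, with the robber's current
   vertex. *)
pose ok (p : strategy G k * G) := legal_from p.1 p.2 /\ ~ win (p.1 [::]) p.2.
have /choice[f fP] p : exists y,
    ok p -> adj p.2 y /\ ok (fun h => p.1 (p.2 :: h), y).
  case: p => u y.
  case: (pselect (ok (u, y))) => [[/= uL uy]|?]; last by exists y.
  apply: contrapT => noz; apply: uy.
  have stay : walk (fun _ => y) by move=> n; apply: adj_refl.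
  apply: (@win_step _ _ _ (u [:: y])) => [i|z yz].
    exact: (uL _ stay erefl 0).
  apply: contrapT => uz; apply: noz; exists z => _; split=> //; split=> //= r rW r0 n i.
  pose w m := if m is l.+1 then r l else y.
  have wW : walk w by apply: walk_cons; rewrite ?r0.
  by have := uL _ wW erefl n.+1 i; rewrite !(mkseqS_head w).
pose st n := iter n (fun p => (fun h => p.1 (p.2 :: h), f p)) (s, x).
have stP n : ok (st n) by elim: n => [|n IH] //=; apply: (proj2 (fP _ IH)).
pose r n := (st n).2.
have stE n h : (st n).1 h = s (mkseq r n ++ h).
  elim: n h => [//|n IH] h.
  by rewrite mkseqS cat_rcons -IH.
exists r; split=> // [n|n]; first exact: (proj1 (fP _ (stP n))).
by have [_] := stP n; rewrite stE cats0.
Qed.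

(** * Subtrees of the decomposition and their territories *)

Definition avoid (I : finType) (t : rel I) (o : option I) : rel I :=
  [rel a b | [&& t a b, o != Some a & o != Some b]].

(** For an edge [ij] of a tree, [side t (Some i) j] is the subtree hanging from
    [j] away from [i]; [side t None j] is the whole tree. *)
Definition side (I : finType) (t : rel I) (o : option I) (j : I) : {set I} :=
  [set l | connect (avoid t o) j l].

Definition territory (G : refl_graph) (I : finType) (t : rel I) (X : I -> {set G})
    (o : option I) (j : I) : {set G} :=
  \bigcup_(l in side t o j) X l.

Definition frontier (G : refl_graph) (I : finType) (X : I -> {set G})
    (o : option I) (j : I) : {set G} :=
  if o is Some i then X i :&: X j else set0.

Lemma side_self (I : finType) (t : rel I) (o : option I) (j : I) : j \in side t o j.
Proof. by rewrite inE connect0. Qed.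

Lemma side_None (I : finType) (t : rel I) (j : I) : tree t -> side t None j = setT.
Proof.
move=> [_ _ _ tC _]; apply/setP => l; rewrite !inE.
by rewrite (@eq_connect _ _ t) ?tC // => a b; rewrite /avoid /= !andbT.
Qed.

Lemma side_step (I : finType) (t : rel I) (i j k l : I) :
  t k l -> k != i -> l != i -> k \in side t (Some i) j -> l \in side t (Some i) j.
Proof.
move=> tkl ki li; rewrite !inE => jk; apply: connect_trans jk (connect1 _).
by rewrite /avoid /= tkl !(inj_eq Some_inj) ![i == _]eq_sym ki li.
Qed.

(** The empty path is an exception because it has no edge that could test whether [j] is [i]. *)
Lemma avoid_path (I : finType) (t : rel I) (i j : I) (p : seq I) :
  path (avoid t (Some i)) j p = path t j p && ((p == [::]) || (i \notin j :: p)).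
Proof.
elim: p j => [|a p IH] j //=; rewrite IH /avoid /= !(inj_eq Some_inj).
rewrite ![i \in _ :: _]inE !negb_or; case: p {IH} => [|b p] /=.
  by case: (t j a); case: (i == j); case: (i == a).
by case: (t j a); case: (i == j); case: (i == a); rewrite /= ?andbF /= ?andbF.
Qed.

Lemma side_neq (I : finType) (t : rel I) (i j k : I) :
  i != j -> k \in side t (Some i) j -> k != i.
Proof.
move=> ij; rewrite inE => /connectP[p]; rewrite avoid_path => /andP[_].
case: eqP => [-> _ ->|_ /= ip ->]; first by rewrite eq_sym.
by apply: contraNneq ip => <-; apply: mem_last.
Qed.

(** A second neighbour of [i] on this side would close a cycle through [i] and [j] of length at
    least 3. *)
Lemma side_adjacent (I : finType) (t : rel I) (i j k : I) :
  tree t -> t i j -> k \in side t (Some i) j -> t k i -> k = j.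
Proof.
move=> [_ _ tI _ tA] tij; have ij : i != j by apply: contraTneq tij => ->; rewrite tI.
rewrite inE => /connectP[p pP ->]; case/shortenP: pP => [[|a q]] //= pP pU _ tki.
have := avoid_path t i j (a :: q); rewrite /= pP => /esym/andP[/andP[tja aq] ip].
have /tA : ucycle t [:: i, j, a & q] by rewrite /ucycle /= rcons_path tij tja aq tki ip pU.
by [].
Qed.

(** The only way out of the side is the edge from [j] to [i]. *)
Lemma side_crossing (I : finType) (t : rel I) (i j k : I) (p : seq I) :
  tree t -> t i j -> k \in side t (Some i) j -> path t k p ->
  last k p \notin side t (Some i) j -> (i \in k :: p) && (j \in k :: p).
Proof.
move=> tT tij; have [_ _ tI _ _] := tT.
have ij : i != j by apply: contraTneq tij => ->; rewrite tI.
elim: p k => [|a p IH] k ks /=; first by rewrite ks.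
move=> /andP[tka ap] lp; case: (boolP (a \in side t (Some i) j)) => [as_|aNs].
  by have /andP[ia ja] := IH a as_ ap lp; rewrite ![_ \in k :: _]inE ia ja !orbT.
have ai : a = i.
  by apply: contraNeq aNs => ai; exact: side_step tka (side_neq ij ks) ai ks.
move: tka; rewrite ai => /(side_adjacent tT tij ks) ->.
by rewrite !inE !eqxx orbT.
Qed.

(** Some bag [l] contains both [x] and [y]. Were [l] off the side, the tree path to it from a bag of
    [x] on the side would pass through [i] and [j], forcing [x] into both of their bags, hence into
    the frontier. *)
Lemma territory_adj (G : refl_graph) (I : finType) (t : rel I) (X : I -> {set G})
    (o : option I) (j : I) (x y : G) :
  tree_decomposition t X -> (forall i, o = Some i -> t i j) ->
  x \in territory t X o j -> x \notin frontier X o j -> adj x y ->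
  y \in territory t X o j.
Proof.
move=> [tT _ Xe Xp] oj /bigcupP[k ks xk] xF /Xe[l [xl yl]].
apply/bigcupP; exists l => //; have [_ _ _ tC _] := tT.
case: o oj ks xF => [i /(_ i erefl) tij ks|_ _ _]; last first.
  by rewrite side_None ?inE.
apply: contraR => /= lNs; have /connectP[q qP lE] := tC k l.
case/shortenP: qP lE => p pP pU _ lE.
have := @side_crossing _ _ _ _ k p tT tij ks pP; rewrite -lE => /(_ lNs)/andP[ip jp].
have xkl : x \in X k :&: X l by rewrite inE xk.
by rewrite inE !(subsetP (Xp k l _ p pP pU (esym lE) _)).
Qed.

Lemma territory_walk (G : refl_graph) (I : finType) (t : rel I) (X : I -> {set G})
    (o : option I) (j : I) (r : nat -> G) :
  tree_decomposition t X -> (forall i, o = Some i -> t i j) ->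
  walk r -> r 0 \in territory t X o j ->
  (forall n, r n \notin frontier X o j) -> forall n, r n \in territory t X o j.
Proof.
move=> tX oj rW r0 rF; elim=> [//|n IH].
exact: territory_adj tX oj IH (rF n) (rW n).
Qed.

(** Take for [k] the first step from [j] towards a bag containing [x]; the new side is smaller
    because it loses [j]. *)
Lemma territory_branch (G : refl_graph) (I : finType) (t : rel I) (X : I -> {set G})
    (o : option I) (j : I) (x : G) :
  tree t -> (forall i, o = Some i -> t i j) ->
  x \in territory t X o j -> x \notin X j ->
  exists k, [/\ t j k, #|side t (Some j) k| < #|side t o j| &
                x \in territory t X (Some j) k].
Proof.
move=> tT oj /bigcupP[l ls xl] xNj; have [_ _ tI _ _] := tT.
move: (ls); rewrite inE => /connectP[q qP lE].
case/shortenP: qP lE => -[|k p] /=; first by move=> _ _ _ lE; rewrite -lE xl in xNj.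
move=> /andP[jk kp] /andP[jNp _] _ lE; have [/= tjk oj' ok] := and3P jk.
have {}kp : path t k p by apply: sub_path kp => a b /and3P[].
have kside l' : l' \in side t (Some j) k -> l' \in side t o j.
  case: o oj ls jk oj' ok => [i /(_ i erefl) tij ls jk _ ki|]; last by rewrite side_None ?inE.
  have ks : k \in side t (Some i) j by rewrite inE; apply: connect1 jk.
  rewrite inE => /connectP[r]; rewrite avoid_path => /andP[kr /orP[/eqP->|jNr] ->] //.
  by apply: contraR jNr => /(side_crossing tT tij ks kr)/andP[_ ->].
exists k; split=> //.
  apply/proper_card/properP; split; first by apply/subsetP.
  exists j; first exact: side_self.
  have kj : j != k by apply: contraTneq tjk => ->; rewrite tI.
  by apply/negP => /(side_neq kj); rewrite eqxx.
apply/bigcupP; exists l => //; rewrite inE lE; apply/connectP; exists p => //.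
by rewrite avoid_path jNp orbT andbT.
Qed.

(** * Confining the robber to ever smaller territories *)

Lemma clique_hub (G : refl_graph) (A : {set G}) (x : G) :
  clique A -> exists y, forall v, v \in A -> adj y v.
Proof.
move=> Acl; case: (set_0Vmem A) => [->|[y yA]]; first by exists x => v; rewrite inE.
by exists y => v; apply: Acl.
Qed.

(** Induction on the number of bags on the robber's side. The extra cop need only be adjacent to all
    of the frontier, and the other [m] cops may start anywhere. *)
Lemma win_branch (G : refl_graph) (I : finType) (t : rel I) (X : I -> {set G})
    (m : nat) (o : option I) (j : I) (c : 'I_(m + 1) -> G) (x : G) :
  connected_graph G -> tree_decomposition t X ->
  (forall i k : I, i != k -> clique (X i :&: X k)) ->
  (forall i, cops_guard (X i) m) ->
  (forall i, o = Some i -> t i j) ->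
  (forall v, v \in frontier X o j -> adj (c (rshift m ord0)) v) ->
  x \in territory t X o j -> win c x.
Proof.
move=> Gconn tX Xcl Xg.
have [b lt_b] := ubnP #|side t o j|.
elim: b => // b IH in o j c x lt_b *; move=> oj.
(* The extra cop, the last one, is adjacent to the whole frontier, so a robber
   who steps on it is caught. *)
have catch (c' : 'I_(m + 1) -> G) (A : {set G}) y :
    (forall v, v \in A -> adj (c' (rshift m ord0)) v) -> ~ win c' y -> y \notin A.
  move=> c'A nw; apply/negP => yA; apply: nw.
  pose d := cops_join (fun i => c' (lshift 1 i)) (fun _ : 'I_1 => y).
  apply: (@win_catch _ _ _ d _ (rshift m ord0)); last by rewrite /d cops_join_rshift.
  rewrite -[c']cops_join_shift /d; apply: cops_join_adj => i; first exact: adj_refl.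
  by rewrite ord1; apply: c'A.
rewrite -[c]cops_join_shift.
move: (fun i => c (lshift 1 i)) (fun i => c (rshift m i)) => {}c e.
rewrite cops_join_rshift => eF xT.
apply: contrapT => nw.
have [s sL sG] := Xg j; have [w [wadj w0 [D wD]]] := walks_to c (s [::]) Gconn.
(* While the guards travel they ignore the robber: their positions depend only on the length of the
   history. *)
have [r1 [r1W r10 r1nw]] : exists r, [/\ walk r, r 0 = x &
    forall n, ~ win (cops_join (w n) e) (r n)].
  pose S : strategy G (m + 1) := fun h => cops_join (w (size h)) e.
  have [||r [rW r0 rnw]] := @not_win_walk _ _ S x.
  - move=> r _ _ n; rewrite /S !size_mkseq; apply: cops_join_adj => // i.
    exact: adj_refl.
  - by rewrite /S w0.
  by exists r; split=> // n; have := rnw n; rewrite /S size_mkseq.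
have {nw xT r10} : r1 D \in territory t X o j.
  apply: (territory_walk tX oj r1W) => [|n]; first by rewrite r10.
  by apply: catch (r1nw n); rewrite cops_join_rshift.
(* The others now stand where their guarding strategy starts. *)
have := r1nw D; rewrite wD; move: (r1 D) => {c w wadj w0 D wD r1 r1W r1nw} {}x nw xT.
have [r [rW r0 rnw]] : exists r, [/\ walk r, r 0 = x &
    forall n, ~ win (cops_join (s (mkseq r n)) e) (r n)].
  apply: (@not_win_walk _ _ (fun h => cops_join (s h) e)) => // r rW _ n.
  by apply: cops_join_adj => i; [apply: sL | apply: adj_refl].
have rT : forall n, r n \in territory t X o j.
  apply: (territory_walk tX oj rW) => [|n]; first by rewrite r0.
  by apply: catch (rnw n); rewrite cops_join_rshift.
(* A catch by the guards would come at once or on their next move, so the position would be a win by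
   [win_catch]. *)
have not_caught (r' : nat -> G) (e1 e2 : 'I_1 -> G) n : walk r' ->
    (forall i, adj (e1 i) (e2 i)) ->
    ~ win (cops_join (s (mkseq r' n)) e1) (r' n) -> ~ caught s r' n.
  move=> r'W e12 nw' [i ci]; apply: nw'; case: ci => ci.
    apply: (@win_catch _ _ _ (cops_join (s (mkseq r' n)) e1) _ (lshift 1 i)).
      by move=> l; apply: adj_refl.
    by rewrite cops_join_lshift.
  apply: (@win_catch _ _ _ (cops_join (s (mkseq r' n.+1)) e2) _ (lshift 1 i)).
    by apply: cops_join_adj => // l; apply: sL.
  by rewrite cops_join_lshift.
have e_refl i : adj (e i) (e i) by apply: adj_refl.
have rnc n : ~ caught s r n by apply: not_caught (rnw n).
have [N NP] := sG r rW.
have rNX : r N \notin X j.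
  by apply/negP => rN; apply: (rnc N); apply: NP.
have tT : tree t by case: tX.
have [k [tjk ltk rNk]] := territory_branch tT oj (rT N) rNX.
have jk : j != k by case: tT => _ _ tI _ _; apply: contraTneq tjk => ->; rewrite tI.
have [e' e'P] := clique_hub x (Xcl j k jk).
have [w [wW w0 [D wD]]] := walk_to (e ord0) e' Gconn.
(* The guards resume their strategy after the history [mkseq r N], on which the
   guard is in place. *)
pose S : strategy G (m + 1) := fun h =>
  cops_join (s (mkseq r N ++ h)) (fun _ => w (size h)).
have SE r2 n : S (mkseq r2 n) =
    cops_join (s (mkseq (splice N r r2) (N + n))) (fun _ => w n).
  by rewrite /S mkseq_splice size_mkseq.
have [||r2 [r2W r20 r2nw]] := @not_win_walk _ _ S (r N).
- move=> r2 r2W r20 n; rewrite !SE (addnS N); apply: cops_join_adj => // i.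
  by apply: sL; apply: walk_splice.
- rewrite /S cats0 w0 (_ : (fun _ => _) = e) //.
  by apply: funext => i; rewrite ord1.
(* The spliced walk agrees with [r] up to time [N], so the guard in place on [r] also binds it. *)
have r'W := walk_splice rW r2W r20.
have r'E n : n <= N -> splice N r r2 n = r n by apply: splice_le.
have r'nc n : ~ caught s (splice N r r2) n.
  case: (ltnP n N) => [ltnN|leNn].
    have := rnc n; rewrite /caught r'E 1?ltnW //.
    by rewrite !(@eq_mkseq_lt _ (splice N r r2) r) // => l ltl;
      apply: r'E; apply: ltnW; apply: (leq_trans ltl); rewrite // ltnW.
  rewrite -(subnKC leNn); move: (n - N) => {leNn} {}n.
  apply: (not_caught _ (fun _ => w n) (fun _ => w n.+1)) => //.
  by have := r2nw n; rewrite SE spliceD.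
have r2X n : r2 n \notin X j.
  rewrite -(spliceD N r r2); apply/negP => r2n; apply: (r'nc (N + n)).
  by apply: NP => //; apply: leq_addr.
(* At time [D] the extra cop has reached [e']. The robber never entered [X j], which contains the
   new frontier, so he is still in the smaller territory. *)
apply: (r2nw D); rewrite SE wD //.
apply: (IH (Some j) k).
- exact: leq_trans ltk _.
- by move=> _ [<-].
- by move=> v vF; rewrite cops_join_rshift; apply: e'P.
apply: (territory_walk tX _ r2W) => [_ [<-] //||n]; first by rewrite r20.
by apply: contra (r2X n) => /setIP[].
Qed.

Theorem theorem3 (G : refl_graph) (I : finType) (t : rel I) (X : I -> {set G}) :
  connected_graph G ->
  tree_decomposition t X ->
  (forall i j : I, i != j -> clique (X i :&: X j)) ->
  cop_number G <= (\max_(i : I) rcc (X i)) + 1.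
Proof.
move=> Gconn tX Xcl; set m := \max_(i : I) rcc (X i).
rewrite /cop_number; case: ex_minnP => k _ kmin.
(* On the empty graph there is no robber walk, and zero cops win. *)
case: (pickP (mem [set: G])) => [x _|G0]; last first.
  apply: leq_trans (kmin 0 _) _ => //; apply/asboolP.
  exists (fun _ (i : 'I_0) => False_rect G (notF (ltn_ord i))) => [r _ n []|r] //.
  by have := G0 (r 0); rewrite !inE.
apply: kmin; apply/asboolP; apply: (@win_cops_win _ _ (fun _ => x)) => y.
have [[/card_gt0P[i0 _] _ _ _ _] XT _ _] := tX.
apply: (win_branch (o := None) (j := i0) Gconn tX Xcl) => [i||v|] //.
- by apply: rcc_cops_guard => //; apply: leq_bigmax.
- by rewrite inE.
have /bigcupP[l _ yl] : y \in \bigcup_i X i by rewrite XT inE.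
by apply/bigcupP; exists l; rewrite // side_None ?inE //; case: tX.
Qed.
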